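(* Let $D:\mathfrak a\to\mathfrak b$ be a right deformation map of a quasi-twilled Lie conformal algebra $(\mathcal E,\mathfrak a,\mathfrak b)$. For a $\mathbb C[\partial]$-module homomorphism $D':\mathfrak a\to\mathfrak b$, the sum $D+D'$ is a right deformation map if and only if $D'$ is a Maurer-Cartan element of the twisted $L_\infty$-algebra $\bigl(\bigoplus_{n\ge0}\mathscr C^{n+1}(\mathfrak a,\mathfrak b),l_1^D,l_2^D\bigr)$: $$l_1^D(D')+\tfrac12l_2^D(D',D')=0,$$ where $l_1^D(f)=l_1(f)+l_2(D,f)$, $l_2^D(f,g)=l_2(f,g)$ and $l_k^D=0$ for $k\ge3$, with $l_1(f)=[\widehat\nu_1,\widehat f\,]_{NR}$ and $l_2(f,g)=[[\widehat\nu_2,\widehat f\,]_{NR},\widehat g\,]_{NR}$.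
   Context: All vector spaces and linear maps are over $\mathbb C$, and all $\mathbb C[\partial]$-modules are finitely generated. A Lie conformal algebra is a $\mathbb C[\partial]$-module $\mathcal E$ with a $\mathbb C$-linear map $\mathcal E\otimes\mathcal E\to\mathcal E[\lambda]$, $x\otimes y\mapsto\{x_\lambda y\}$, such that $\{\partial x_\lambda y\}=-\lambda\{x_\lambda y\}$, $\{x_\lambda\partial y\}=(\partial+\lambda)\{x_\lambda y\}$, $\{x_\lambda y\}=-\{y_{-\lambda-\partial}x\}$ and $\{x_\lambda\{y_\mu z\}\}=\{\{x_\lambda y\}_{\lambda+\mu}z\}+\{y_\mu\{x_\lambda z\}\}$ ($\partial$ in a subscript acts from the left on the coefficients). A quasi-twilled Lie conformal algebra $(\mathcal E,\mathfrak a,\mathfrak b)$ is a Lie conformal algebra with a $\mathbb C[\partial]$-module decomposition $\mathcal E=\mathfrak a\oplus\mathfrak b$ such that $\mathfrak b$ is a subalgebra. For $a,b\in\mathfrak a$, $u,v\in\mathfrak b$ set $\{a_\lambda b\}_{\mathfrak a}=\mathrm{pr}_{\mathfrak a}\{a_\lambda b\}$, $\psi_{1,\lambda}(a,b)=\mathrm{pr}_{\mathfrak b}\{a_\lambda b\}$, $\varrho_{\mathfrak b}(u)_\lambda a=\mathrm{pr}_{\mathfrak a}\{u_\lambda a\}$, $\varrho_{\mathfrak a}(a)_\lambda v=\mathrm{pr}_{\mathfrak b}\{a_\lambda v\}$, $\{u_\lambda v\}_{\mathfrak b}=\{u_\lambda v\}$. A right deformation map is a $\mathbb C[\partial]$-module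 homomorphism $D:\mathfrak a\to\mathfrak b$ whose graph $\{(a,D(a))\mid a\in\mathfrak a\}$ is a Lie conformal subalgebra of $\mathcal E$. Cochains: for $\mathbb C[\partial]$-modules $M,N$ and $k\ge1$, $\mathscr C^k(M,N)$ is the space of $\mathbb C$-linear maps $\varphi:M^{\otimes k}\to\mathbb C[\lambda_1,\dots,\lambda_{k-1}]\otimes N$ such that, with $\lambda_k^\ddagger:=-\sum_{j=1}^{k-1}\lambda_j-\partial$ ($\partial$ acting on $N$ from the left), (i) $\varphi(\dots,\partial a_i,\dots)=-\lambda_i\varphi(\dots,a_i,\dots)$ for $1\le i\le k-1$ and $\varphi(\dots,\partial a_k)=-\lambda_k^\ddagger\varphi(\dots,a_k)$; (ii) for every permutation $\sigma$, $\varphi_{\lambda_1,\dots,\lambda_{k-1}}(a_1,\dots,a_k)=(-1)^\sigma\varphi_{\lambda_{\sigma(1)},\dots,\lambda_{\sigma(k-1)}}(a_{\sigma(1)},\dots,a_{\sigma(k)})|_{\lambda_k\mapsto\lambda_k^\ddagger}$. In particular $\mathscr C^1(M,N)=\mathrm{Hom}_{\mathbb C[\partial]}(M,N)$. Nijenhuis-Richardson bracket: for $f\in\mathscr C^m(\mathcal E,\mathcal E)$, $g\in\mathscr C^n(\mathcal E,\mathcal E)$, $[f,g]_{NR}:=f\star g-(-1)^{(m-1)(n-1)}g\star f$, with $$(f\star g)_{\lambda_1,\dots,\lambda_{m+n-2}}(x_1,\dots,x_{m+n-1})=\sum_{\sigma}(-1)^\sigma f_{\lambda_{\sigma(1)}+\cdots+\lambda_{\sigma(n)},\lambda_{\sigma(n+1)},\dots,\lambda_{\sigma(m+n-2)}}\bigl(g_{\lambda_{\sigma(1)},\dots,\lambda_{\sigma(n-1)}}(x_{\sigma(1)},\dots,x_{\sigma(n)}),x_{\sigma(n+1)},\dots,x_{\sigma(m+n-1)}\bigr)\big|_{\lambda_{m+n-1}\mapsto\lambda_{m+n-1}^\ddagger}$$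 over $(n,m-1)$-unshuffles (i.e. $\sigma(1)<\dots<\sigma(n)$ and $\sigma(n+1)<\dots<\sigma(m+n-1)$). The $\lambda$-bracket $\Omega$ of $\mathcal E$ decomposes as $\Omega=\widehat\psi+\widehat\nu_1+\widehat\nu_2$ with $\widehat\psi_\lambda((a,u),(b,v))=(0,\psi_{1,\lambda}(a,b))$, $\widehat\nu_{1,\lambda}((a,u),(b,v))=(\{a_\lambda b\}_{\mathfrak a},\varrho_{\mathfrak a}(a)_\lambda v-\varrho_{\mathfrak a}(b)_{-\lambda-\partial}u)$, $\widehat\nu_{2,\lambda}((a,u),(b,v))=(\varrho_{\mathfrak b}(u)_\lambda b-\varrho_{\mathfrak b}(v)_{-\lambda-\partial}a,\{u_\lambda v\}_{\mathfrak b})$. For $f\in\mathscr C^k(\mathfrak a,\mathfrak b)$, $\widehat f((a_1,u_1),\dots,(a_k,u_k))=(0,f(a_1,\dots,a_k))$; $f$ is identified with $\widehat f$. The space $\bigoplus_{n\ge0}\mathscr C^{n+1}(\mathfrak a,\mathfrak b)$, graded with $\mathscr C^{n+1}$ in degree $n$, with $l_0=\widehat\psi$, $l_1(f)=[\widehat\nu_1,\widehat f\,]_{NR}$, $l_2(f,g)=[[\widehat\nu_2,\widehat f\,]_{NR},\widehat g\,]_{NR}$ and $l_k=0$ for $k\ge3$, is a curved $L_\infty$-algebra (graded symmetric, degree $1$ operations) of which $D$ is a Maurer-Cartan element: $l_0+l_1(D)+\frac12l_2(D,D)=0$; the twisted structure $l^D_k$ is an $L_\infty$-algebra. *)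

(* Defs.v *)
From HB Require Import structures.
From mathcomp Require Import all_boot all_order all_algebra all_fingroup.
From mathcomp Require Import finmap.
From mathcomp Require Import -(notations) monalg.
From mathcomp Require Import ssrcomplements mpoly.

Set Implicit Arguments.
Unset Strict Implicit.
Unset Printing Implicit Defensive.

Import GRing.Theory.
Local Open Scope ring_scope.

(** The ground field is [F]; a [C[d]]-module is an [lmodType {poly F}], with
    the derivation [d] acting as ['X *: _] and a scalar [c] as [c%:P *: _]. *)

Definition finitely_generated (F : fieldType) (N : lmodType {poly F}) : Prop :=
  exists s : seq N, forall x : N,
    exists c : nat -> {poly F}, x = \sum_(i < size s) c i *: s`_i.

(** [C[lambda_1, ..., lambda_n] (x) N]: an element is the finitely supported
    family of its coefficients, indexed by the monomials in the lambdas. *)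
Definition lampoly (F : fieldType) (n : nat) (N : lmodType {poly F}) : Type :=
  @malg 'X_{1..n} N.

HB.instance Definition _ (F : fieldType) n (N : lmodType {poly F}) :=
  GRing.Zmodule.copy (lampoly n N) (@malg 'X_{1..n} N).

Section LamPoly.
Context {F : fieldType} {n : nat} {N : lmodType {poly F}}.
Implicit Types (f g : lampoly n N) (m : 'X_{1..n}) (p q : {mpoly {poly F}[n]}).

Definition lsupp f : {fset 'X_{1..n}} := monalg.msupp f.
Definition lcoef f m : N := monalg.mcoeff m f.
Definition lmono m (y : N) : lampoly n N := monalg.mkmalgU m y.
Definition lconst (y : N) : lampoly n N := lmono 0%MM y.

End LamPoly.

(** [lampoly n N] is a module over [C[d][lambda_1, ..., lambda_n]], the
    derivation acting on the coefficients. *)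
HB.lock Definition lact (F : fieldType) n (N : lmodType {poly F})
    (p : {mpoly {poly F}[n]}) (f : lampoly n N) : lampoly n N :=
  \sum_(m1 <- mpoly.msupp p) \sum_(m2 <- lsupp f)
    lmono (m1 + m2) (p@_m1 *: lcoef f m2).

Section LamPolyModule.
Context {F : fieldType} {n : nat} {N : lmodType {poly F}}.
Implicit Types (f g : lampoly n N) (m : 'X_{1..n}) (p q : {mpoly {poly F}[n]}).

Fact lmonoD m (y z : N) : lmono m (y + z) = lmono m y + lmono m z.
Proof. exact: monalgUD. Qed.

Fact lmono0 m : lmono m (0 : N) = 0.
Proof. exact: monalgU0. Qed.

Fact lampolyE f : f = \sum_(m <- lsupp f) lmono m (lcoef f m).
Proof. exact: monalgE. Qed.

Fact lsumE (V : zmodType) (h : 'X_{1..n} -> N -> V) (d : {fset 'X_{1..n}}) f :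
    (forall m, h m 0 = 0) -> (lsupp f `<=` d)%fset ->
  \sum_(m <- lsupp f) h m (lcoef f m) = \sum_(m <- d) h m (lcoef f m).
Proof.
move=> h0 /fsubsetP le_d; apply: big_fset_incl; first exact/fsubsetP.
by move=> m _ /mcoeff_outdom mf; rewrite /lcoef mf h0.
Qed.

Fact lsumD (V : zmodType) (h : 'X_{1..n} -> N -> V) f g :
    (forall m y z, h m (y + z) = h m y + h m z) ->
  \sum_(m <- lsupp (f + g)) h m (lcoef (f + g) m) =
  \sum_(m <- lsupp f) h m (lcoef f m) + \sum_(m <- lsupp g) h m (lcoef g m).
Proof.
move=> hD.
have h0 m : h m 0 = 0 by apply: (addrI (h m 0)); rewrite -hD !addr0.
rewrite !(@lsumE V h (lsupp f `|` lsupp g)%fset) ?fsubsetUl ?fsubsetUr //;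
  last exact: monalg.msuppD_le.
by rewrite -big_split; apply: eq_bigr => m _ /=; rewrite -hD /lcoef -monalg.mcoeffD.
Qed.

Fact lsum_mono (V : zmodType) (h : 'X_{1..n} -> N -> V) m y :
  (forall m', h m' 0 = 0) ->
  \sum_(m' <- lsupp (lmono m y)) h m' (lcoef (lmono m y) m') = h m y.
Proof.
move=> h0; rewrite (@lsumE V h [fset m]%fset) ?monalg.msuppU_le //.
by rewrite big_seq_fset1 /lcoef /lmono monalg.mcoeffUU.
Qed.

Fact lact_coefE p f (d : nat) : (msize p <= d)%N ->
  lact p f = \sum_(m1 : 'X_{1..n < d}) \sum_(m2 <- lsupp f)
    lmono (m1 + m2) (p@_m1 *: lcoef f m2).
Proof.
move=> le_pd; rewrite lact.unlock.
rewrite (big_mksub 'X_{1..n < d}) ?msupp_uniq //=; first last.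
  by move=> m /msize_mdeg_lt /leq_trans; apply.
rewrite big_rmcond //= => m /memN_msupp_eq0 ->.
by rewrite big1 // => m2 _; rewrite scale0r lmono0.
Qed.

Fact lactDl f p q : lact (p + q) f = lact p f + lact q f.
Proof.
pose d := maxn (msize (p + q)) (maxn (msize p) (msize q)).
rewrite !(@lact_coefE _ f d) /d ?leq_maxl ?leq_max ?leqnn ?orbT //.
rewrite -big_split; apply: eq_bigr => m _; rewrite -big_split.
by apply: eq_bigr => m2 _; rewrite mpoly.mcoeffD scalerDl lmonoD.
Qed.

Fact lactDr p f g : lact p (f + g) = lact p f + lact p g.
Proof.
rewrite lact.unlock -big_split; apply: eq_bigr => m1 _ /=.
by rewrite (lsumD (h := fun m2 y => lmono (m1 + m2) (p@_m1 *: y))) //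
  => m y z; rewrite scalerDr lmonoD.
Qed.

Fact lact_mono (c : {poly F}) m m' (y : N) :
  lact (c *: 'X_[m]) (lmono m' y) = lmono (m + m') (c *: y).
Proof.
have [->|c0] := eqVneq c 0.
  by rewrite !scale0r lmono0 lact.unlock msupp0 big_nil.
rewrite lact.unlock msuppMCX // big_seq1 mpoly.mcoeffZ mcoeffX eqxx.
rewrite (lsum_mono (h := fun m2 y => lmono (m + m2) (_ *: y))).
  by rewrite mulr1.
by move=> ?; rewrite scaler0 lmono0.
Qed.

Fact lampoly_ind (P : lampoly n N -> Prop) :
  P 0 -> (forall m y f, P f -> P (lmono m y + f)) -> forall f, P f.
Proof. by move=> P0 PD f; rewrite [f]lampolyE; elim/big_rec: _ => // *; exact: PD. Qed.

Fact lact0r p : lact p 0 = 0 :> lampoly n N.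
Proof. by apply: (addrI (lact p 0)); rewrite -lactDr !addr0. Qed.

Fact lact0l f : lact 0 f = 0.
Proof. by rewrite lact.unlock msupp0 big_nil. Qed.

Fact lactA p q f : lact p (lact q f) = lact (p * q) f.
Proof.
elim/lampoly_ind: f => [|m y f IHf]; first by rewrite !lact0r.
rewrite !lactDr {}IHf; congr (_ + _).
elim/mpolyind: q => [|c m1 q _ _ IHq]; first by rewrite mulr0 !lact0l lact0r.
rewrite mulrDr !lactDl lactDr {}IHq; congr (_ + _).
elim/mpolyind: p => [|d m2 p _ _ IHp]; first by rewrite mul0r !lact0l.
rewrite mulrDl !lactDl {}IHp; congr (_ + _).
by rewrite -scalerAl -scalerAr scalerA -mpolyXD !lact_mono scalerA addmA.
Qed.

Fact lact1 : left_id 1 (@lact F n N).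
Proof.
move=> f; elim/lampoly_ind: f => [|m y f IHf]; first exact: lact0r.
by rewrite lactDr IHf -[1]mpolyX0 -[X in lact X _]scale1r lact_mono add0m scale1r.
Qed.

Fact lact_Dl f : {morph (@lact F n N)^~ f : p q / p + q}.
Proof. by move=> p q; exact: lactDl. Qed.

End LamPolyModule.

HB.instance Definition _ (F : fieldType) n (N : lmodType {poly F}) :=
  GRing.Zmodule_isLmodule.Build {mpoly {poly F}[n]} (lampoly n N)
    lactA lact1 lactDr lact_Dl.

(** The derivation, as a scalar of [lampoly n N]. *)
Definition del {F : fieldType} (n : nat) : {mpoly {poly F}[n]} := ('X)%:MP.

(** [lamext P h g] replaces [lambda_j] by [P j] in [g] and applies [h] to the
    coefficients of [g].  The derivation occurring in [P] acts from the left,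
    i.e. on the coefficients of the values of [h]. *)
Definition lamext {F : fieldType} {q r : nat} {M N : lmodType {poly F}}
    (P : 'I_q -> {mpoly {poly F}[r]}) (h : M -> lampoly r N)
    (g : lampoly q M) : lampoly r N :=
  \sum_(m <- lsupp g) (\prod_(j < q) P j ^+ m j) *: h (lcoef g m).

Definition lamsubst {F : fieldType} {q r : nat} {N : lmodType {poly F}}
    (P : 'I_q -> {mpoly {poly F}[r]}) : lampoly q N -> lampoly r N :=
  lamext P lconst.

Definition lammap {F : fieldType} {n : nat} {M N : lmodType {poly F}}
    (h : M -> N) : lampoly n M -> lampoly n N :=
  lamext (fun j => 'X_j) (fun y => lconst (h y)).

Section LieConformal.
Context {F : fieldType} {E : lmodType {poly F}}.
Variable br : E -> E -> lampoly 1 E.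

Local Notation lambda := ('X_ord0 : {mpoly {poly F}[1]}).
Local Notation lambda2 := ('X_ord0 : {mpoly {poly F}[2]}).
Local Notation mu2 := ('X_ord_max : {mpoly {poly F}[2]}).

Record lie_conformal_algebra : Prop := LieConformalAlgebra {
  lca_linearl : forall (c : F) x x' y,
    br (c%:P *: x + x') y = c%:P%:MP *: br x y + br x' y;
  lca_linearr : forall (c : F) x y y',
    br x (c%:P *: y + y') = c%:P%:MP *: br x y + br x y';
  lca_derl : forall x y, br ('X *: x) y = (- lambda) *: br x y;
  lca_derr : forall x y, br x ('X *: y) = (del 1 + lambda) *: br x y;
  lca_skew : forall x y,
    br x y = - lamsubst (fun=> - lambda - del 1) (br y x);
  lca_jacobi : forall x y z,
    lamext (fun=> mu2) (fun w => lamsubst (fun=> lambda2) (br x w)) (br y z)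
    = lamext (fun=> lambda2)
        (fun w => lamsubst (fun=> lambda2 + mu2) (br w z)) (br x y)
    + lamext (fun=> lambda2)
        (fun w => lamsubst (fun=> mu2) (br y w)) (br x z)
}.

Record lie_conformal_subalgebra (S : E -> Prop) : Prop :=
  LieConformalSubalgebra {
    lcs_zero : S 0;
    lcs_add : forall x y, S x -> S y -> S (x + y);
    lcs_scale : forall (p : {poly F}) x, S x -> S (p *: x);
    lcs_bracket : forall x y m, S x -> S y -> S (lcoef (br x y) m)
  }.

End LieConformal.

(** [cochain_map n M N] is the type of the maps underlying the elements of
    [C^(n+1)(M, N)]; the arguments are numbered from [0] to [n]. *)
Definition cochain_map {F : fieldType} (n : nat) (M N : lmodType {poly F}) :=
  {ffun 'I_n.+1 -> M} -> lampoly n N.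

(** [lambda_1, ..., lambda_n] followed by
    [lambda_(n+1)^ddagger = - (lambda_1 + ... + lambda_n) - d]. *)
Definition lam {F : fieldType} {n : nat} (i : 'I_n.+1) : {mpoly {poly F}[n]} :=
  if unlift ord_max i is Some j then 'X_j else - \sum_(j < n) 'X_j - del n.

Definition set_arg {M : Type} {n : nat} (x : {ffun 'I_n -> M}) (i : 'I_n)
    (y : M) : {ffun 'I_n -> M} :=
  [ffun j => if j == i then y else x j].

Record is_cochain {F : fieldType} {n : nat} {M N : lmodType {poly F}}
    (phi : cochain_map n M N) : Prop := IsCochain {
  cochain_linear : forall x i (c : F) (y z : M),
    phi (set_arg x i (c%:P *: y + z)) =
      c%:P%:MP *: phi (set_arg x i y) + phi (set_arg x i z);
  cochain_sesquilinear : forall x i,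
    phi (set_arg x i ('X *: x i)) = (- lam i) *: phi x;
  cochain_skew : forall (s : 'S_n.+1) x,
    phi x = (-1) ^+ s *:
      lamsubst (fun j => lam (s (lift ord_max j))) (phi [ffun i => x (s i)])
}.

Definition hom_cochain {F : fieldType} {M N : lmodType {poly F}}
    (D : {linear M -> N}) : cochain_map 0 M N :=
  fun x => lconst (D (x ord0)).

Definition unshuffle {r : nat} (k : nat) (s : 'S_r) : bool :=
  [forall i : 'I_r, forall j : 'I_r,
     (i < j)%N && ((j < k)%N || (k <= i)%N) ==> (s i < s j)%N].

Section NijenhuisRichardson.
Context {F : fieldType} {E : lmodType {poly F}}.

(** The product [f * g], for [f] of arity [m = p + 1] and [g] of arity
    [n = q + 1].  It is only used for [r = p + q]; keeping [r] separate avoids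
    a cast between [p + q] and [q + p] in the bracket.  Positions are
    numbered from [0].  Writing [lam] for the variables performs the
    substitution [lambda_(m+n-1) |-> lambda_(m+n-1)^ddagger] at once. *)
Definition nr_prod {p q : nat} (r : nat) (f : cochain_map p E E)
    (g : cochain_map q E E) : cochain_map r E E := fun x =>
  \sum_(s : 'S_r.+1 | unshuffle q.+1 s)
    (-1) ^+ s *:
    lamext (fun j : 'I_q => lam (s (inord j)))
      (fun y =>
         lamsubst
           (fun i : 'I_p =>
              if i == 0%N :> nat then \sum_(j < q.+1) lam (s (inord j))
              else lam (s (inord (q + i)%N)))
           (f [ffun i : 'I_p.+1 =>
                 if i == 0%N :> nat then y else x (s (inord (q + i)%N))]))
      (g [ffun j : 'I_q.+1 => x (s (inord j))]).

Arguments nr_prod {p q} r f g x.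

Definition nr_bracket {p q : nat} (f : cochain_map p E E)
    (g : cochain_map q E E) : cochain_map (p + q)%N E E := fun x =>
  nr_prod (p + q)%N f g x - (-1) ^+ (p * q)%N *: nr_prod (p + q)%N g f x.

End NijenhuisRichardson.

Section QuasiTwilled.
Context {F : fieldType} {a b : lmodType {poly F}}.

Local Notation E := (a * b)%type.

Definition quasi_twilled (Omega : E -> E -> lampoly 1 E) : Prop :=
  lie_conformal_algebra Omega
  /\ lie_conformal_subalgebra Omega (fun x => x.1 = 0).

Variable Omega : E -> E -> lampoly 1 E.

Definition right_deformation_map (D : {linear a -> b}) : Prop :=
  lie_conformal_subalgebra Omega (fun x => x.2 = D x.1).

Definition bracket_a (x y : a) : lampoly 1 a :=
  lammap fst (Omega (x, 0) (y, 0)).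
Definition rho_b (u : b) (x : a) : lampoly 1 a :=
  lammap fst (Omega (0, u) (x, 0)).
Definition rho_a (x : a) (v : b) : lampoly 1 b :=
  lammap snd (Omega (x, 0) (0, v)).
Definition bracket_b (u v : b) : lampoly 1 b :=
  lammap snd (Omega (0, u) (0, v)).

Definition lampair {n : nat} (f : lampoly n a) (g : lampoly n b) :
    lampoly n E :=
  lammap (fun x => (x, 0)) f + lammap (fun u => (0, u)) g.

Definition reflect_lambda {N : lmodType {poly F}} :
    lampoly 1 N -> lampoly 1 N :=
  lamsubst (fun=> - 'X_ord0 - del 1).

Definition nu1_hat : cochain_map 1 E E := fun x =>
  let: (a1, u) := x ord0 in let: (b1, v) := x ord_max in
  lampair (bracket_a a1 b1) (rho_a a1 v - reflect_lambda (rho_a b1 u)).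

Definition nu2_hat : cochain_map 1 E E := fun x =>
  let: (a1, u) := x ord0 in let: (b1, v) := x ord_max in
  lampair (rho_b u b1 - reflect_lambda (rho_b v a1)) (bracket_b u v).

Definition hat {n : nat} (f : cochain_map n a b) : cochain_map n E E :=
  fun x => lammap (fun u => (0, u)) (f [ffun i => (x i).1]).

(** The operations on the sum of the [C^(n+1)(a, b)], given on homogeneous
    components; [C^(n+1)(a, b)] is identified with its image under [hat], and
    the values are written as elements of the cochains of [E]. *)
Definition l1 {n : nat} (f : cochain_map n a b) : cochain_map n.+1 E E :=
  nr_bracket nu1_hat (hat f).

Definition l2 {m n : nat} (f : cochain_map m a b) (g : cochain_map n a b) :
    cochain_map (m + n).+1 E E :=
  nr_bracket (nr_bracket nu2_hat (hat f)) (hat g).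

Definition twisted_l1 (D : {linear a -> b}) {n : nat} (f : cochain_map n a b) :
    cochain_map n.+1 E E :=
  fun x => l1 f x + l2 (hom_cochain D) f x.

Definition twisted_l2 (D : {linear a -> b}) {m n : nat}
    (f : cochain_map m a b) (g : cochain_map n a b) :
    cochain_map (m + n).+1 E E :=
  l2 f g.

(** The Maurer-Cartan equation stops at [k = 2], as the twisted [l_k] vanish
    for [k >= 3]. *)
Definition twisted_maurer_cartan (D : {linear a -> b})
    (f : cochain_map 0 a b) : Prop :=
  is_cochain f
  /\ forall x, twisted_l1 D f x + (2%:R^-1)%:P%:MP *: twisted_l2 D f f x = 0.

End QuasiTwilled.

(* Main.v *)
From HB Require Import structures.
Require Import Defs.
From mathcomp Require Import all_boot all_order all_algebra.
From mathcomp Require Import all_fingroup ssrAC finmap.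
From mathcomp Require Import -(notations) monalg.
From mathcomp Require Import mpoly.
From mathcomp Require Import complex.
From mathcomp Require Import reals.
Import GRing.Theory.
Local Open Scope ring_scope.

(** A homomorphism [D : a -> b] has an obstruction to being a right
    deformation map, its graph defect: writing [Omega_a] and [Omega_b] for the
    components of the bracket,
      [graph_defect D p q = Omega_b (P, Q) - D (Omega_a (P, Q))]
    with [P = (p, D p)] and [Q = (q, D q)],
    which vanishes for all [p, q] exactly when the graph of [D] is closed under
    the bracket ([right_deformation_defectP]).  As the bracket is biadditive
    and [Omega_a] vanishes on [b], the defect is a polynomial of degree at most
    two in [D]: its value at [D + D'] is its value at [D], plus a part linear
    in [D'], plus a part quadratic in [D'] ([graph_defectD]).

    On the other side, the Nijenhuis-Richardson bracket of a skew-symmetric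
    [nu] with a homomorphism [G] is the usual variation
      [nu (G x) y + nu x (G y) - G (nu x y)]
    ([nr_bracket_hom]).  Skew-symmetry of the bracket of [E] turns the
    reflected terms of [nu1_hat] and [nu2_hat] into components of that bracket
    ([nu1_hatE], [nu2_hatE]), so the formula applies once for [l1] and twice
    for [l2].  Then [l1 D'] together with [l2 D D'] is the linear part of the
    expansion of the defect, and [l2 D' D'] is twice its quadratic part, which
    accounts for the factor one half.  Hence the left-hand side of the
    Maurer-Cartan equation of [D'] is the difference of the defects of [D + D']
    and of [D] ([twisted_maurer_cartanE]); the latter is zero, and the
    equivalence follows. *)

(** * Polynomials in the lambdas with coefficients in a module *)

Section Lamext.
Context {F : fieldType} {q r : nat} {M N : lmodType {poly F}}.
Implicit Types (P : 'I_q -> {mpoly {poly F}[r]}) (h : M -> lampoly r N).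

Lemma lampolyP (f g : lampoly q M) : (forall m, lcoef f m = lcoef g m) -> f = g.
Proof. by move=> fg; apply/malgP. Qed.

Lemma lcoefD (f g : lampoly q M) m : lcoef (f + g) m = lcoef f m + lcoef g m.
Proof. exact: monalg.mcoeffD. Qed.

Lemma lcoef0 m : lcoef (0 : lampoly q M) m = 0.
Proof. exact: monalg.mcoeff0. Qed.

Lemma lcoefN (f : lampoly q M) m : lcoef (- f) m = - lcoef f m.
Proof. exact: monalg.mcoeffN. Qed.

Lemma lcoefB (f g : lampoly q M) m : lcoef (f - g) m = lcoef f m - lcoef g m.
Proof. by rewrite lcoefD lcoefN. Qed.

Lemma lcoef_mono (m : 'X_{1..q}) (y : M) k :
  lcoef (lmono m y) k = if m == k then y else 0.
Proof. by rewrite /lcoef /lmono monalg.mcoeffU; case: (m == k). Qed.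

Lemma eq_lamext P P' h h' g :
  P =1 P' -> h =1 h' -> lamext P h g = lamext P' h' g.
Proof.
move=> eqP eqh; rewrite /lamext; apply: eq_bigr => m _; rewrite eqh.
by congr (_ *: _); apply: eq_bigr => j _; rewrite eqP.
Qed.

Lemma lamext_mono P h m (y : M) :
  h 0 = 0 -> lamext P h (lmono m y) = (\prod_(j < q) P j ^+ m j) *: h y.
Proof.
move=> h0; rewrite /lamext.
by rewrite (lsum_mono (h := fun m z => (\prod_(j < q) P j ^+ m j) *: h z)) //
   => k; rewrite h0 scaler0.
Qed.

Lemma lamext_const P h (y : M) : h 0 = 0 -> lamext P h (lconst y) = h y.
Proof.
move=> h0; rewrite lamext_mono // big1 ?scale1r // => j _.
by rewrite mnm0E expr0.
Qed.

Lemma lamext0 P h : lamext P h 0 = 0.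
Proof. by rewrite /lamext /lsupp monalg.msupp0 big_seq_fset0. Qed.

Lemma lamextD P h (hD : {morph h : x y / x + y}) f g :
  lamext P h (f + g) = lamext P h f + lamext P h g.
Proof.
rewrite /lamext.
by rewrite (lsumD (h := fun m z => (\prod_(j < q) P j ^+ m j) *: h z)) // => m y z;
   rewrite hD scalerDr.
Qed.

End Lamext.

Section Lamsubst.
Context {F : fieldType} {q r : nat} {N : lmodType {poly F}}.
Variable P : 'I_q -> {mpoly {poly F}[r]}.
Implicit Types f g : lampoly q N.

Lemma lamsubst0 : lamsubst P (0 : lampoly q N) = 0.
Proof. exact: lamext0. Qed.

Lemma lamsubstD f g : lamsubst P (f + g) = lamsubst P f + lamsubst P g.
Proof. by apply: lamextD => x y; exact: lmonoD. Qed.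

Lemma lamsubst_mono m (y : N) :
  lamsubst P (lmono m y) = (\prod_(j < q) P j ^+ m j) *: lconst y.
Proof. by apply: lamext_mono; exact: lmono0. Qed.

Lemma lamsubst_const (y : N) : lamsubst P (lconst y) = lconst y.
Proof. by apply: lamext_const; exact: lmono0. Qed.

End Lamsubst.

Section Lammap.
Context {F : fieldType} {n : nat} {M N : lmodType {poly F}}.

(** With this lemma, an identity between values of [lammap] is checked on the
    coefficients. *)
Lemma lcoef_lammap (h : M -> N) (f : lampoly n M) m :
  h 0 = 0 -> lcoef (lammap h f) m = h (lcoef f m).
Proof.
move=> h0; rewrite /lammap /lamext.
under eq_bigr => k _.
  rewrite -mpolyXE_id -[X in X *: _]scale1r /lconst.
  rewrite [_ *: _](lact_mono 1) addm0 scale1r; over.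
rewrite /lcoef raddf_sum /=.
under eq_bigr => k _ do rewrite [monalg.mcoeff _ _]lcoef_mono.
have [mf|mf] := boolP (m \in lsupp f).
  rewrite (big_fsetD1 m) //= eqxx big_seq big1 ?addr0 // => k.
  by rewrite !inE => /andP[/negPf->].
rewrite (mcoeff_outdom mf) h0 big_seq big1 // => k kf.
by case: eqP => [km|//]; rewrite -km kf in mf.
Qed.

Lemma lammapD {h : M -> N} (hD : {morph h : x y / x + y}) (f g : lampoly n M) :
  lammap h (f + g) = lammap h f + lammap h g.
Proof. by apply: lamextD => x y; rewrite hD /lconst lmonoD. Qed.

End Lammap.

Lemma lcoef_lammap2 {F : fieldType} {n : nat} {M M' N : lmodType {poly F}}
    (h : M -> N) (h' : M' -> N) (f : lampoly n M) (f' : lampoly n M') m :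
  h 0 = 0 -> h' 0 = 0 ->
  lcoef (lammap h f + lammap h' f') m = h (lcoef f m) + h' (lcoef f' m).
Proof.
by move=> h0 h'0; rewrite lcoefD; congr (_ + _); exact: lcoef_lammap.
Qed.

Section LammapLinear.
Context {F : fieldType} {M N : lmodType {poly F}}.
Context {h : M -> N}.
Hypotheses (hD : {morph h : x y / x + y})
  (hZ : forall (p : {poly F}) x, h (p *: x) = p *: h x).

Lemma lin0 : h 0 = 0.
Proof. by rewrite -(scale0r 0) hZ scale0r. Qed.

Lemma lammap_mono n m y : lammap (n := n) h (lmono m y) = lmono m (h y).
Proof.
apply: lampolyP => k; rewrite lcoef_lammap ?lin0 // !lcoef_mono.
by case: eqP; rewrite ?lin0.
Qed.

Lemma lammap0 n : lammap h 0 = 0 :> lampoly n N.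
Proof. by rewrite -(lmono0 0%MM) lammap_mono lin0 lmono0. Qed.

Lemma lammapN n (f : lampoly n M) : lammap h (- f) = - lammap h f.
Proof.
by apply: (addrI (lammap h f)); rewrite -(lammapD hD) !subrr lammap0.
Qed.

Lemma lammapZ n (p : {mpoly {poly F}[n]}) (f : lampoly n M) :
  lammap h (p *: f) = p *: lammap h f.
Proof.
elim/(@lampoly_ind F n M): f => [|m y f IHf].
  by rewrite !scaler0 lammap0 scaler0.
rewrite scalerDr !(lammapD hD) scalerDr {}IHf; congr (_ + _).
elim/(@mpolyind n {poly F}): p => [|c m1 p _ _ IHp].
  by rewrite !scale0r lammap0.
rewrite !scalerDl (lammapD hD) {}IHp; congr (_ + _).
rewrite lammap_mono [_ *: lmono _ _]lact_mono [_ *: lmono _ (h y)]lact_mono.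
by rewrite lammap_mono hZ.
Qed.

(** The derivation that a substitution brings in acts on the coefficients, so
    the commutation uses that [h] is linear over the polynomials in the
    derivation, and not only over the ground field. *)
Lemma lammap_subst q r (P : 'I_q -> {mpoly {poly F}[r]}) (f : lampoly q M) :
  lammap h (lamsubst P f) = lamsubst P (lammap h f).
Proof.
elim/(@lampoly_ind F q M): f => [|m y f IHf].
  by rewrite lamsubst0 !lammap0 lamsubst0.
rewrite lamsubstD [LHS](lammapD hD) [lammap h (_ + _)](lammapD hD) lamsubstD.
congr (_ + _); last exact: IHf.
by rewrite lammap_mono 2!lamsubst_mono lammapZ lammap_mono.
Qed.

End LammapLinear.

Lemma half_double {F : fieldType} {n : nat} {N : lmodType {poly F}}
    (X : lampoly n N) :
  2%:R != 0 :> F -> (2%:R^-1)%:P%:MP *: (X + X) = X.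
Proof.
move=> two_neq0.
have inv2 : (2%:R^-1)%:P%:MP * 2%:R = 1 :> {mpoly {poly F}[n]}.
  have -> : 2%:R = (2%:R : F)%:P%:MP :> {mpoly {poly F}[n]}.
    by rewrite !rmorph_nat.
  by rewrite -mpolyCM -polyCM mulVf.
by rewrite -mulr2n -scaler_nat scalerA inv2 scale1r.
Qed.

(** * The Nijenhuis-Richardson bracket with a homomorphism *)

Section NRHom.
Context {F : fieldType} {E : lmodType {poly F}}.
Implicit Types (nu : E -> E -> lampoly 1 E) (x y : E) (G : {linear E -> E}).

Definition skew_bracket nu : Prop :=
  forall x y, reflect_lambda (nu y x) = - nu x y.

(** The variation of [nu] along [G]; it vanishes when [G] is a derivation of
    [nu]. *)
Definition insert_hom G nu x y : lampoly 1 E :=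
  nu (G x) y + nu x (G y) - lammap G (nu x y).

Lemma lamsubst_id (f : lampoly 1 E) : lamsubst (fun=> 'X_ord0) f = f.
Proof.
transitivity (lammap id f).
  by apply: eq_lamext => // j; rewrite (ord1 j).
by apply: lampolyP => m; rewrite lcoef_lammap.
Qed.

Lemma lam0E : lam (ord0 : 'I_2) = 'X_ord0 :> {mpoly {poly F}[1]}.
Proof.
rewrite /lam; case: unliftP => [j|/(congr1 val)//].
by rewrite ord1.
Qed.

Lemma lam1E : lam (ord_max : 'I_2) = - 'X_ord0 - del 1 :> {mpoly {poly F}[1]}.
Proof. by rewrite /lam unlift_none big_ord1. Qed.

Lemma perm2_eq (s t : 'S_2) : s ord0 = t ord0 -> s = t.
Proof.
have ord2_neq (i j k : 'I_2) : i != k -> j != k -> i = j.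
  by case: i j k => [[|[|//]] ?] [[|[|//]] ?] [[|[|//]] ?] // _ _; exact: val_inj.
move=> st0; apply/permP => i; case: (i =P ord0) => [->//|/eqP i0].
by apply: (ord2_neq _ _ (s ord0)); last rewrite st0; rewrite (inj_eq perm_inj).
Qed.

Lemma sum_S2 (V : zmodType) (f : 'S_2 -> V) :
  \sum_s f s = f 1%g + f (tperm ord0 ord_max).
Proof.
rewrite (bigD1 1%g) //= (bigD1 (tperm ord0 ord_max)) /=; last first.
  by apply/eqP => /permP/(_ ord0); rewrite perm1 tpermL.
rewrite big1 ?addr0 // => s /andP[s1 s2]; exfalso.
case: (s ord0 =P ord0) => [s0|/eqP s0].
  by case/eqP: s1; apply: perm2_eq; rewrite perm1.
case/eqP: s2; apply: perm2_eq; rewrite tpermL.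
by case: (s ord0) s0 => [[|[|//]] ?] // _; apply: val_inj.
Qed.

(** The two unshuffles that contribute to [c * f] insert [G] into either slot.
    The transposition evaluates [c] with the slots exchanged and at the
    reflected variable, which skew-symmetry converts back into
    [nu x (G y)]; the only unshuffle in [f * c] is the identity.  The vanishing
    of [nu] at [0] is needed because [lamext] skips the zero coefficient. *)
Lemma nr_bracket_hom (c : cochain_map 1 E E) nu (G : {linear E -> E})
    (f : cochain_map 0 E E) (x : {ffun 'I_2 -> E}) :
  (forall z, c z = nu (z ord0) (z ord_max)) ->
  (forall y, nu 0 y = 0) -> skew_bracket nu ->
  (forall z, f z = lconst (G (z ord0))) ->
  nr_bracket c f x = insert_hom G nu (x ord0) (x ord_max).
Proof.
move=> cE nu0 nu_skew fE.
rewrite /nr_bracket muln0 expr0 scale1r /insert_hom; congr (_ - _).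
  rewrite /nr_prod big_mkcond /= sum_S2.
  have uns (s : 'S_2) : unshuffle 1 s.
    by apply/forallP => -[[|[|//]] ?]; apply/forallP => -[[|[|//]] ?].
  rewrite !uns odd_perm1 odd_tperm expr0 expr1 scale1r scaleN1r.
  have in0 : inord 0 = ord0 :> 'I_2 by apply: val_inj; rewrite /= inordK.
  have in1 : inord 1 = ord_max :> 'I_2 by apply: val_inj; rewrite /= inordK.
  (* The term of the unshuffle [s], with [y] the value of [f]. *)
  have slot (s : 'S_2) y :
      lamsubst (fun i : 'I_1 =>
          if i == 0%N :> nat then \sum_(k < 1) lam (s (inord k))
          else lam (s (inord (0 + i)%N)))
        (c [ffun i : 'I_2 =>
              if i == 0%N :> nat then y else x (s (inord (0 + i)%N))])
      = lamsubst (fun=> lam (s ord0)) (nu y (x (s ord_max))).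
    rewrite cE !ffunE /= add0n in1; apply: eq_lamext => // i.
    by rewrite (ord1 i) /= big_ord1 in0.
  rewrite !fE !ffunE !lamext_const ?slot ?nu0 ?lamsubst0 //.
  rewrite /= in0 !perm1 tpermL tpermR lam0E lam1E lamsubst_id.
  by rewrite -/(reflect_lambda _) nu_skew opprK.
rewrite /nr_prod (bigD1 1%g) /=; last first.
  apply/forallP => i; apply/forallP => k.
  by rewrite !perm1; apply/implyP => /andP[].
rewrite [X in _ + X]big1 ?addr0 =>
  [|s /andP[/forallP/(_ ord0)/forallP/(_ ord_max) /= s01 s1]].
  rewrite odd_perm1 expr0 scale1r cE !ffunE.
  have inE (k : 'I_2) : inord k = k by apply: val_inj; rewrite /= inordK.
  rewrite (inE ord0) (inE ord_max) !perm1.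
  apply: eq_lamext => [k|y].
    rewrite perm1 (ord1 k) (inE ord0); exact: lam0E.
  by rewrite fE ffunE lamsubst_const.
case/eqP: s1; apply: perm2_eq; rewrite perm1.
by move: s01; case: (s ord0) (s ord_max) => [[|[|//]] ?] [[|[|//]] ?] //= _;
  exact: val_inj.
Qed.

Lemma reflectN (N : lmodType {poly F}) (f : lampoly 1 N) :
  reflect_lambda (- f) = - reflect_lambda f.
Proof.
apply: (addrI (reflect_lambda f)).
by rewrite -[LHS]lamsubstD !subrr [LHS]lamsubst0.
Qed.

(** Skew-symmetry and vanishing at [0] are inherited by the variation, so that
    [nr_bracket_hom] can be iterated. *)
Lemma insert_hom_skew G nu : skew_bracket nu -> skew_bracket (insert_hom G nu).
Proof.
move=> nuS x y; rewrite /insert_hom.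
rewrite [LHS]lamsubstD [X in X + _]lamsubstD -!/(reflect_lambda _) reflectN.
rewrite /(reflect_lambda (lammap G _)).
rewrite -(lammap_subst (raddfD G) (linearZ_LR G)) -/(reflect_lambda _) !nuS (lammapN (raddfD G) (linearZ_LR G)).
by rewrite [RHS]opprD [X in X + _ = _]addrC [X in _ = X + _]opprD.
Qed.

Lemma insert_hom0l G nu :
  (forall y, nu 0 y = 0) -> forall y, insert_hom G nu 0 y = 0.
Proof.
move=> nu0 y; rewrite /insert_hom raddf0 !nu0 (lammap0 (linearZ_LR G)).
by rewrite subr0 addr0.
Qed.

End NRHom.

(** * Expansion of the graph defect *)

(** Only additivity matters for this expansion, so it is carried out for
    additive groups: [A], [B] stand for the two summands, [VA], [VB] for the
    groups in which the components [Wa], [Wb] of the bracket take their values,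
    and [Dl : VA -> VB] for the action of [D : A -> B] on values. *)
Section GraphDefect.
Context {A B VA VB : zmodType}.
Local Notation E := (A * B)%type.
Variables (Wa : E -> E -> VA) (Wb : E -> E -> VB).

(** The components of [nu1_hat] and [nu2_hat], free of reflections. *)
Definition nu1_a (x y : E) := Wa (x.1, 0) (y.1, 0).
Definition nu1_b (x y : E) := Wb (x.1, 0) (0, y.2) + Wb (0, x.2) (y.1, 0).
Definition nu2_a (x y : E) := Wa (0, x.2) (y.1, 0) + Wa (x.1, 0) (0, y.2).
Definition nu2_b (x y : E) := Wb (0, x.2) (0, y.2).

Definition hom_hat (D : A -> B) (x : E) : E := (0, D x.1).

(** The components of the variation along [hom_hat D] of a bracket with
    components [na] and [nb]; as [hom_hat D] has values in the second summand,
    its action on values contributes to the second component only. *)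
Definition insert_a (D : A -> B) (na : E -> E -> VA) x y :=
  na (hom_hat D x) y + na x (hom_hat D y).
Definition insert_b (D : A -> B) (Dl : VA -> VB) (na : E -> E -> VA)
    (nb : E -> E -> VB) x y :=
  nb (hom_hat D x) y + nb x (hom_hat D y) - Dl (na x y).

Definition graph_defect (D : A -> B) (Dl : VA -> VB) (p q : A) : VB :=
  Wb (p, D p) (q, D q) - Dl (Wa (p, D p) (q, D q)).

Hypotheses
  (WaDl : forall x x' y, Wa (x + x') y = Wa x y + Wa x' y)
  (WaDr : forall x y y', Wa x (y + y') = Wa x y + Wa x y')
  (WbDl : forall x x' y, Wb (x + x') y = Wb x y + Wb x' y)
  (WbDr : forall x y y', Wb x (y + y') = Wb x y + Wb x y')
  (Wa_sub : forall u v, Wa (0, u) (0, v) = 0).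
Implicit Types (D : {additive A -> B}) (Dl : {additive VA -> VB}) (x y : E).

Lemma Wa0l y : Wa 0 y = 0.
Proof. by apply: (addrI (Wa 0 y)); rewrite -WaDl !addr0. Qed.

Lemma Wa0r x : Wa x 0 = 0.
Proof. by apply: (addrI (Wa x 0)); rewrite -WaDr !addr0. Qed.

Lemma Wb0l y : Wb 0 y = 0.
Proof. by apply: (addrI (Wb 0 y)); rewrite -WbDl !addr0. Qed.

Lemma Wb0r x : Wb x 0 = 0.
Proof. by apply: (addrI (Wb x 0)); rewrite -WbDr !addr0. Qed.

Lemma nu1_a_insert D' x y : insert_a D' nu1_a x y = 0.
Proof. by rewrite /insert_a /nu1_a /= Wa0l Wa0r addr0. Qed.

Lemma nu1_b_insert D' Dl' x y : insert_b D' Dl' nu1_a nu1_b x y =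
  Wb (0, D' x.1) (y.1, 0) + Wb (x.1, 0) (0, D' y.1) - Dl' (Wa (x.1, 0) (y.1, 0)).
Proof. by rewrite /insert_b /nu1_b /nu1_a /= Wb0l Wb0r add0r addr0. Qed.

Lemma nu2_a_insert D x y :
  insert_a D nu2_a x y = Wa (0, D x.1) (y.1, 0) + Wa (x.1, 0) (0, D y.1).
Proof. by rewrite /insert_a /nu2_a /= Wa0l Wa0r add0r addr0. Qed.

Lemma nu2_a_insert2 D D' x y : insert_a D' (insert_a D nu2_a) x y = 0.
Proof. by rewrite /insert_a /nu2_a /= !raddf0 !Wa0l !Wa0r !addr0. Qed.

(** The terms with two insertions into one slot drop out, since [hom_hat D] and
    [hom_hat D'] compose to zero; what remains is the polarization of
    [quadratic_part]. *)
Lemma nu2_b_insert2 D D' Dl Dl' x y :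
  insert_b D' Dl' (insert_a D nu2_a) (insert_b D Dl nu2_a nu2_b) x y =
  Wb (0, D' x.1) (0, D y.1) - Dl (Wa (0, D' x.1) (y.1, 0))
  + (Wb (0, D x.1) (0, D' y.1) - Dl (Wa (x.1, 0) (0, D' y.1)))
  - Dl' (Wa (0, D x.1) (y.1, 0) + Wa (x.1, 0) (0, D y.1)).
Proof.
rewrite /insert_b nu2_a_insert /nu2_a /nu2_b /= !raddf0 !Wa0l !Wa0r !Wb0l !Wb0r.
by rewrite !add0r !addr0.
Qed.

Definition quadratic_part (D' : A -> B) (Dl' : VA -> VB) (p q : A) :=
  Wb (0, D' p) (0, D' q) - Dl' (Wa (0, D' p) (q, 0) + Wa (p, 0) (0, D' q)).

Lemma nu2_b_insert2_diag D' Dl' x y :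
  insert_b D' Dl' (insert_a D' nu2_a) (insert_b D' Dl' nu2_a nu2_b) x y =
  quadratic_part D' Dl' x.1 y.1 + quadratic_part D' Dl' x.1 y.1.
Proof.
rewrite nu2_b_insert2 /quadratic_part raddfD !opprD !addrA.
by rewrite [LHS](ACl (1*2*4*3*5*6)%AC).
Qed.

(** The part linear in [D'] has two sources: insertion into [nu1], and into
    [nu2] already varied along [D]. *)
Lemma graph_defectD D D' Dl Dl' x y :
  graph_defect (D \+ D') (Dl \+ Dl') x.1 y.1 = graph_defect D Dl x.1 y.1 +
  (insert_b D' Dl' nu1_a nu1_b x y
   + insert_b D' Dl' (insert_a D nu2_a) (insert_b D Dl nu2_a nu2_b) x y
   + quadratic_part D' Dl' x.1 y.1).
Proof.
have split_pair2 (r : A) : (r, D r + D' r) = (r, 0) + ((0, D r) + (0, D' r)) :> E.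
  by congr pair; rewrite /= ?addr0 ?add0r.
have split_pair (r : A) : (r, D r) = (r, 0) + (0, D r) :> E.
  by congr pair; rewrite /= ?addr0 ?add0r.
rewrite nu1_b_insert nu2_b_insert2 /quadratic_part /graph_defect /=.
rewrite !split_pair2 !split_pair.
rewrite !(WaDl, WaDr, WbDl, WbDr, Wa_sub) !raddfD /= !raddf0 !addr0 !addrA.
(* Both sides are now sums of the same nineteen terms: nine values of [Wb],
   and five images each under [Dl] and [Dl']. *)
by rewrite [LHS](ACl (1*2*4*5*10*11*13*7*3*15*8*14*6*12*18*16*9*19*17)%AC).
Qed.

End GraphDefect.

(** * The components of a bracket on a direct sum *)

Section Lampair.
Context {F : fieldType} {a b : lmodType {poly F}}.
Local Notation E := (a * b)%type.
Implicit Types (f : lampoly 1 a) (g : lampoly 1 b).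

Fact inl_additive : {morph (fun x : a => (x, 0) : E) : x y / x + y}.
Proof. by move=> x y; congr pair; rewrite /= addr0. Qed.

Fact inr_additive : {morph (fun u : b => (0, u) : E) : u v / u + v}.
Proof. by move=> u v; congr pair; rewrite /= addr0. Qed.

Fact inl_scalable (p : {poly F}) (x : a) : (p *: x, 0) = p *: ((x, 0) : E).
Proof. by congr pair; rewrite /= scaler0. Qed.

Fact inr_scalable (p : {poly F}) (u : b) : (0, p *: u) = p *: ((0, u) : E).
Proof. by congr pair; rewrite /= scaler0. Qed.

Lemma lampairD f f' g g' :
  lampair (f + f') (g + g') = lampair f g + lampair f' g' :> lampoly 1 E.
Proof.
by rewrite /lampair (lammapD inl_additive) (lammapD inr_additive); exact: addrACA.
Qed.

Lemma lampair00 : lampair 0 0 = 0 :> lampoly 1 E.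
Proof. by apply: (addrI (lampair 0 0)); rewrite -lampairD !addr0. Qed.

Lemma lampair0D g g' :
  lampair 0 (g + g') = lampair 0 g + lampair 0 g' :> lampoly 1 E.
Proof. by rewrite -lampairD addr0. Qed.

Lemma lampairN f g : lampair (- f) (- g) = - lampair f g :> lampoly 1 E.
Proof.
by apply: (addrI (lampair f g)); rewrite -lampairD !subrr lampair00.
Qed.

Lemma reflect_lampair f g :
  reflect_lambda (lampair f g : lampoly 1 E) =
  lampair (reflect_lambda f) (reflect_lambda g).
Proof.
apply: (etrans (lamsubstD _ _ _)); apply: (f_equal2 +%R); apply: esym.
  exact: (lammap_subst inl_additive inl_scalable).
exact: (lammap_subst inr_additive inr_scalable).
Qed.

Lemma lcoef_lampair f g m :
  lcoef (lampair f g : lampoly 1 E) m = (lcoef f m, lcoef g m).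
Proof.
transitivity ((lcoef f m, 0 : b) + (0 : a, lcoef g m) : E).
  exact: (lcoef_lammap2 (fun x : a => (x, 0 : b)) (fun u : b => (0 : a, u))).
by congr pair; rewrite /= ?addr0 ?add0r.
Qed.

Lemma lampair0_inj g : lampair 0 g = 0 :> lampoly 1 E -> g = 0.
Proof.
move=> g0; apply: lampolyP => m; have := lcoef_lampair 0 g m.
by rewrite g0 !lcoef0 => /(congr1 snd).
Qed.

Fact hom_hat_linear (D : {linear a -> b}) : linear (hom_hat D : E -> E).
Proof.
move=> p x y; rewrite /hom_hat /= linearP.
by congr pair; rewrite /= scaler0 addr0.
Qed.

HB.instance Definition _ (D : {linear a -> b}) :=
  GRing.isLinear.Build {poly F} E E *:%R (hom_hat D) (hom_hat_linear D).

Fact lammap_additive (D : {linear a -> b}) :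
  zmod_morphism (lammap D : lampoly 1 a -> lampoly 1 b).
Proof.
move=> f f'.
by rewrite (lammapD (raddfD D)) (lammapN (raddfD D) (linearZ_LR D)).
Qed.

HB.instance Definition _ (D : {linear a -> b}) :=
  GRing.isZmodMorphism.Build (lampoly 1 a) (lampoly 1 b) (lammap D)
    (lammap_additive D).

Lemma lammap_hom_hat (D : {linear a -> b}) f g :
  lammap (hom_hat D) (lampair f g) = lampair 0 (lammap D f) :> lampoly 1 E.
Proof.
apply: lampolyP => m; rewrite [RHS]lcoef_lampair.
rewrite [LHS](lcoef_lammap (hom_hat D : E -> E)) ?raddf0 //.
rewrite lcoef_lampair lcoef0 /hom_hat /=; congr pair.
by apply/esym; apply: lcoef_lammap; rewrite raddf0.
Qed.

Lemma insert_hom_lampair (D : {linear a -> b}) (nu : E -> E -> lampoly 1 E)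
    na nb :
  (forall x y, nu x y = lampair (na x y) (nb x y)) ->
  forall x y, insert_hom (hom_hat D) nu x y =
    lampair (insert_a D na x y) (insert_b D (lammap D) na nb x y).
Proof.
move=> nuE x y; rewrite /insert_hom !nuE lammap_hom_hat -lampairN oppr0.
by rewrite -lampairD -lampairD addr0.
Qed.

Lemma hat_hom_cochain (D : {linear a -> b}) (z : {ffun 'I_1 -> E}) :
  hat (hom_cochain D) z = lconst (hom_hat D (z ord0)).
Proof.
rewrite /hat /hom_cochain ffunE.
exact: (lammap_mono inr_scalable).
Qed.

End Lampair.

Lemma hom_cochain_is_cochain {F : fieldType} {M N : lmodType {poly F}}
  (D : {linear M -> N}) : is_cochain (hom_cochain D).
Proof.
have scale_const (p : {poly F}) (y : N) :
    p%:MP *: (lconst y : lampoly 0 N) = lconst (p *: y).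
  by rewrite -[p%:MP]mulr1 mul_mpolyC -mpolyX0 [LHS]lact_mono addm0.
split=> [x i c y z|x i|s x]; rewrite /hom_cochain !ffunE.
- by rewrite (ord1 i) eqxx linearP scale_const /lconst lmonoD.
- have -> : lam i = - del 0 :> {mpoly {poly F}[0]}.
    rewrite /lam (_ : i = ord_max) ?unlift_none ?big_ord0 ?oppr0 ?sub0r //.
    by rewrite (ord1 i); apply: val_inj.
  by rewrite (ord1 i) eqxx linearZ /= -scale_const opprK.
rewrite (_ : s = 1%g); last by apply/permP => k; rewrite !ord1.
by rewrite odd_perm1 expr0 scale1r perm1 lamsubst_const.
Qed.

(** * The twisted Maurer-Cartan equation *)

Section QuasiTwilledMaurerCartan.
Context {F : fieldType} {a b : lmodType {poly F}}.
Local Notation E := (a * b)%type.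
Variable Omega : E -> E -> lampoly 1 E.

Definition Omega_a (x y : E) : lampoly 1 a := lammap fst (Omega x y).
Definition Omega_b (x y : E) : lampoly 1 b := lammap snd (Omega x y).

Lemma right_deformation_defectP (D : {linear a -> b}) :
  right_deformation_map Omega D <->
  forall p q, graph_defect Omega_a Omega_b D (lammap D) p q = 0.
Proof.
have lcoef_graph_defect p q m :
    lcoef (graph_defect Omega_a Omega_b D (lammap D) p q) m =
    (lcoef (Omega (p, D p) (q, D q)) m).2 -
    D (lcoef (Omega (p, D p) (q, D q)) m).1.
  rewrite /graph_defect lcoefB; congr (_ - _); first exact: lcoef_lammap.
  apply: etrans (lcoef_lammap _ _ _ (raddf0 D)) _.
  by congr (D _); exact: lcoef_lammap.
split=> [[_ _ _ clos] p q|defect0].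
  by apply: lampolyP => m; rewrite lcoef_graph_defect lcoef0 clos ?subrr.
split=> [|x y|p x|[p u] [q v] m] /=; first by rewrite raddf0.
- by move=> -> ->; rewrite raddfD.
- by move=> ->; rewrite linearZ.
move=> -> ->; apply/eqP; rewrite -subr_eq0 -lcoef_graph_defect defect0.
by rewrite lcoef0.
Qed.

Hypothesis Omega_lie : lie_conformal_algebra Omega.
Hypothesis b_subalgebra : lie_conformal_subalgebra Omega (fun x => x.1 = 0).

Lemma OmegaDl x x' y : Omega (x + x') y = Omega x y + Omega x' y.
Proof.
have := lca_linearl Omega_lie 1 x x' y.
by rewrite polyC1 mpolyC1 !scale1r.
Qed.

Lemma OmegaDr x y y' : Omega x (y + y') = Omega x y + Omega x y'.
Proof.
have := lca_linearr Omega_lie 1 x y y'.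
by rewrite polyC1 mpolyC1 !scale1r.
Qed.

Lemma Omega_aDl x x' y : Omega_a (x + x') y = Omega_a x y + Omega_a x' y.
Proof. by rewrite /Omega_a OmegaDl lammapD. Qed.

Lemma Omega_aDr x y y' : Omega_a x (y + y') = Omega_a x y + Omega_a x y'.
Proof. by rewrite /Omega_a OmegaDr lammapD. Qed.

Lemma Omega_bDl x x' y : Omega_b (x + x') y = Omega_b x y + Omega_b x' y.
Proof. by rewrite /Omega_b OmegaDl lammapD. Qed.

Lemma Omega_bDr x y y' : Omega_b x (y + y') = Omega_b x y + Omega_b x y'.
Proof. by rewrite /Omega_b OmegaDr lammapD. Qed.

Lemma Omega_a_skew x y : reflect_lambda (Omega_a y x) = - Omega_a x y.
Proof.
rewrite /Omega_a.
apply: etrans (esym (@lammap_subst F _ _ fst _ _ 1 1 _ (Omega y x))) _ => //.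
have -> : lamsubst (fun=> - 'X_ord0 - del 1) (Omega y x) = - Omega x y.
  by apply: oppr_inj; rewrite opprK -(lca_skew Omega_lie).
exact: lammapN.
Qed.

Lemma Omega_b_skew x y : reflect_lambda (Omega_b y x) = - Omega_b x y.
Proof.
rewrite /Omega_b.
apply: etrans (esym (@lammap_subst F _ _ snd _ _ 1 1 _ (Omega y x))) _ => //.
have -> : lamsubst (fun=> - 'X_ord0 - del 1) (Omega y x) = - Omega x y.
  by apply: oppr_inj; rewrite opprK -(lca_skew Omega_lie).
exact: lammapN.
Qed.

Lemma Omega_a_sub u v : Omega_a (0, u) (0, v) = 0.
Proof.
apply: lampolyP => m; rewrite lcoef0.
apply: etrans (lcoef_lammap _ _ _ _) _ => //.
exact: (lcs_bracket b_subalgebra).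
Qed.

Definition nu1 x y : lampoly 1 E :=
  lampair (nu1_a Omega_a x y) (nu1_b Omega_b x y).
Definition nu2 x y : lampoly 1 E :=
  lampair (nu2_a Omega_a x y) (nu2_b Omega_b x y).

(** Skew-symmetry of [Omega] identifies each reflected term
    [- reflect_lambda (rho y x)] with a component of [Omega x y], for arguments
    in different summands. *)
Lemma nu1_hatE (z : {ffun 'I_2 -> E}) :
  nu1_hat Omega z = nu1 (z ord0) (z ord_max).
Proof.
rewrite /nu1_hat /nu1; case: (z ord0) => p u; case: (z ord_max) => q v.
apply: (f_equal2 lampair erefl); apply: (f_equal2 +%R erefl).
by apply: oppr_inj; rewrite opprK; exact: Omega_b_skew.
Qed.

Lemma nu2_hatE (z : {ffun 'I_2 -> E}) :
  nu2_hat Omega z = nu2 (z ord0) (z ord_max).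
Proof.
rewrite /nu2_hat /nu2; case: (z ord0) => p u; case: (z ord_max) => q v.
apply: (f_equal2 lampair _ erefl); apply: (f_equal2 +%R erefl).
by apply: oppr_inj; rewrite opprK; exact: Omega_a_skew.
Qed.

Lemma nu1_skew : skew_bracket nu1.
Proof.
move=> x y; rewrite /nu1 reflect_lampair -lampairN.
apply: (f_equal2 lampair).
  exact: Omega_a_skew.
apply: etrans (lamsubstD _ _ _) _.
apply: etrans (f_equal2 +%R (Omega_b_skew _ _) (Omega_b_skew _ _)) _.
by rewrite -opprD addrC.
Qed.

Lemma nu2_skew : skew_bracket nu2.
Proof.
move=> x y; rewrite /nu2 reflect_lampair -lampairN.
apply: (f_equal2 lampair).
  apply: etrans (lamsubstD _ _ _) _.
  apply: etrans (f_equal2 +%R (Omega_a_skew _ _) (Omega_a_skew _ _)) _.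
  by rewrite -opprD addrC.
exact: Omega_b_skew.
Qed.

Lemma nu1_0l y : nu1 0 y = 0.
Proof.
rewrite /nu1 /nu1_a /nu1_b /=.
by rewrite (Wa0l _ Omega_aDl) !(Wb0l _ Omega_bDl) addr0 lampair00.
Qed.

Lemma nu2_0l y : nu2 0 y = 0.
Proof.
rewrite /nu2 /nu2_a /nu2_b /=.
by rewrite !(Wa0l _ Omega_aDl) !(Wb0l _ Omega_bDl) addr0 lampair00.
Qed.

Lemma l1_hom (D : {linear a -> b}) (z : {ffun 'I_2 -> E}) :
  l1 Omega (hom_cochain D) z =
  lampair 0 (insert_b D (lammap D) (nu1_a Omega_a) (nu1_b Omega_b)
               (z ord0) (z ord_max)).
Proof.
transitivity (insert_hom (hom_hat D) nu1 (z ord0) (z ord_max)).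
  apply: nr_bracket_hom; [exact: nu1_hatE|exact: nu1_0l|exact: nu1_skew|].
  exact: hat_hom_cochain.
apply: etrans (insert_hom_lampair D nu1 _ _ (fun _ _ => erefl) _ _) _.
apply: (f_equal2 lampair _ erefl).
exact: (nu1_a_insert Omega_a Omega_aDl Omega_aDr D).
Qed.

Lemma l2_hom (D D' : {linear a -> b}) (z : {ffun 'I_2 -> E}) :
  l2 Omega (hom_cochain D) (hom_cochain D') z =
  lampair 0 (insert_b D' (lammap D') (insert_a D (nu2_a Omega_a))
               (insert_b D (lammap D) (nu2_a Omega_a) (nu2_b Omega_b))
               (z ord0) (z ord_max)).
Proof.
transitivity (insert_hom (hom_hat D') (insert_hom (hom_hat D) nu2)
    (z ord0) (z ord_max)).
  apply: nr_bracket_hom.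
  - move=> t; apply: nr_bracket_hom;
      [exact: nu2_hatE|exact: nu2_0l|exact: nu2_skew|].
    exact: hat_hom_cochain.
  - by apply: insert_hom0l; exact: nu2_0l.
  - by apply: insert_hom_skew; exact: nu2_skew.
  exact: hat_hom_cochain.
have nu2_insert := insert_hom_lampair D nu2 _ _ (fun _ _ => erefl).
apply: etrans (insert_hom_lampair D' _ _ _ nu2_insert _ _) _.
apply: (f_equal2 lampair _ erefl).
exact: (nu2_a_insert2 Omega_a Omega_aDl Omega_aDr D D').
Qed.

Lemma twisted_maurer_cartanE (D D' : {linear a -> b}) (z : {ffun 'I_2 -> E}) :
  2%:R != 0 :> F ->
  twisted_l1 Omega D (hom_cochain D') z +
    (2%:R^-1)%:P%:MP *: twisted_l2 Omega D (hom_cochain D') (hom_cochain D') z =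
  lampair 0 (graph_defect Omega_a Omega_b (D \+ D') (lammap D \+ lammap D')
               (z ord0).1 (z ord_max).1
             - graph_defect Omega_a Omega_b D (lammap D)
                 (z ord0).1 (z ord_max).1).
Proof.
move=> two_neq0; rewrite /twisted_l1 /twisted_l2.
have quadE := nu2_b_insert2_diag _ _ Omega_aDl Omega_aDr Omega_bDl Omega_bDr
  D' (lammap D') (z ord0) (z ord_max).
have l2E := l2_hom D' D' z; rewrite quadE lampair0D in l2E.
apply: etrans (f_equal2 +%R (f_equal2 +%R (l1_hom D' z) (l2_hom D D' z))
  (etrans (f_equal _ l2E) (half_double _ two_neq0))) _.
apply: etrans (esym
  (etrans (lampair0D _ _) (f_equal2 +%R (lampair0D _ _) erefl))) _.
apply: (f_equal (lampair 0)).
have -> := graph_defectD _ _ Omega_aDl Omega_aDr Omega_bDl Omega_bDr Omega_a_sub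
  D D' (lammap D) (lammap D') (z ord0) (z ord_max).
by rewrite [RHS]addrC addKr.
Qed.

Lemma right_deformation_add (D D' : {linear a -> b}) :
  2%:R != 0 :> F -> right_deformation_map Omega D ->
  right_deformation_map Omega (D \+ D') <->
  twisted_maurer_cartan Omega D (hom_cochain D').
Proof.
move=> two_neq0 /right_deformation_defectP defD.
apply: iff_trans (right_deformation_defectP _) _.
have lammap_sum f :
    lammap (D \+ D') f = lammap D f + lammap D' f :> lampoly 1 b.
  apply: lampolyP => m; rewrite lcoefD.
  apply: etrans (lcoef_lammap _ _ _ (raddf0 (D \+ D'))) _.
  by apply: (f_equal2 +%R); apply: esym; apply: lcoef_lammap; exact: raddf0.
have defE p q :
    graph_defect Omega_a Omega_b (D \+ D') (lammap (D \+ D')) p q =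
    graph_defect Omega_a Omega_b (D \+ D') (lammap D \+ lammap D') p q.
  by rewrite /graph_defect lammap_sum.
split=> [defDD'|[_ mc] p q].
  split; first exact: hom_cochain_is_cochain.
  move=> z; apply: etrans (twisted_maurer_cartanE D D' z two_neq0) _.
  by rewrite -defE defDD' defD subr0 lampair00.
pose z : {ffun 'I_2 -> E} := [ffun k => if k == ord0 then (p, 0) else (q, 0)].
have := etrans (esym (twisted_maurer_cartanE D D' z two_neq0)) (mc z).
by move/lampair0_inj; rewrite !ffunE /= defD subr0 -defE.
Qed.

End QuasiTwilledMaurerCartan.

Theorem theorem3p25 (R : realType) (a b : lmodType {poly R[i]})
    (Omega : a * b -> a * b -> lampoly 1 (a * b)%type)
    (D : {linear a -> b}) (D' : {linear a -> b}) :
  finitely_generated a -> finitely_generated b ->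
  quasi_twilled Omega ->
  right_deformation_map Omega D ->
  (right_deformation_map Omega (D \+ D') <->
   twisted_maurer_cartan Omega D (hom_cochain D')).
Proof.
move=> _ _ [Omega_lie b_sub]; apply: right_deformation_add => //.
by rewrite Num.Theory.pnatr_eq0.
Qed.
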